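(* Let $f:\mathbb{R}^n\to\mathbb{R}$ be twice-differentiable and suppose there are constants $0<\mu\le L$ such that $\mu I\preceq\nabla^2 f(x)\preceq L I$ for all $x\in\mathbb{R}^n$ (i.e. $f$ is $\mu$-strongly convex with $L$-Lipschitz continuous gradient), and that the Hessian is $M$-Lipschitz continuous: $\|\nabla^2 f(x)-\nabla^2 f(y)\|\le M\|x-y\|$ for all $x,y\in\mathbb{R}^n$. Let $x_*$ be the minimizer of $f$. Let $(x_k)_{k\ge 0}$ be any sequence in $\mathbb{R}^n$ that decreases the function at least as much as the pure Newton step, that is, for every $k\ge 0$, $$f(x_{k+1})\le f\big(x_k-\nabla^2 f(x_k)^{-1}\nabla f(x_k)\big).$$ Then for every $k\ge 0$, $$\|x_{k+1}-x_*\|\le\sqrt{\frac{L}{\mu}}\,\frac{M}{2\mu}\,\|x_k-x_*\|^2.$$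
   Context: Here $A\preceq B$ for symmetric matrices means $B-A$ is positive semidefinite, and $I$ is the $n\times n$ identity matrix. The norm $\|\cdot\|$ is the Euclidean norm for vectors and the spectral norm for matrices. *)

(* Defs.v *)
From mathcomp Require Import all_boot all_order all_algebra.
From mathcomp Require Import all_classical all_reals all_analysis.
Set Implicit Arguments.
Unset Strict Implicit.
Unset Printing Implicit Defensive.
Import Order.TTheory GRing.Theory Num.Theory.
Import numFieldNormedType.Exports.
Local Open Scope classical_set_scope.
Local Open Scope ring_scope.

(* The library's norm `|v| on matrices is the sup norm of the entries; it
   induces the same topology and the same notion of differentiability as the
   Euclidean norm, but the two norms differ as numbers. *)
Definition enorm (R : realType) (n : nat) (v : 'cV[R]_n) : R :=
  Num.sqrt (\sum_(i < n) v i 0 ^+ 2).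

(* Operator norm induced by the Euclidean norm. The set is nonempty (v = 0)
   and bounded, so sup is a genuine supremum, including for n = 0. *)
Definition specnorm (R : realType) (m n : nat) (A : 'M[R]_(m, n)) : R :=
  sup [set enorm (A *m v) | v in [set v : 'cV[R]_n | enorm v <= 1]].

(* Positive semidefiniteness is expressed by the quadratic form only. Symmetry
   is not part of the definition, so that using it on a Hessian does not
   assume the symmetry of second derivatives. *)
Definition psdmx (R : realType) (n : nat) (A : 'M[R]_n) : Prop :=
  forall v : 'cV[R]_n, 0 <= (v^T *m A *m v) 0 0.

Definition loewner_le (R : realType) (n : nat) (A B : 'M[R]_n) : Prop :=
  psdmx (B - A).

Definition gradient (R : realType) (n : nat) (f : 'cV[R]_n -> R)
    (x : 'cV[R]_n) : 'cV[R]_n :=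
  \col_(i < n) 'D_(delta_mx i 0) f x.

Definition hessian (R : realType) (n : nat) (f : 'cV[R]_n -> R)
    (x : 'cV[R]_n) : 'M[R]_n :=
  \matrix_(i < n, j < n)
    'D_(delta_mx i 0) (fun y => 'D_(delta_mx j 0) f y) x.

(* Fréchet differentiability of f and of its gradient at every point; the mere
   existence of the partial derivatives would be strictly weaker. *)
Definition twice_differentiable (R : realType) (n : nat)
    (f : 'cV[R]_n -> R) : Prop :=
  (forall x, differentiable f x) /\ (forall x, differentiable (gradient f) x).

(* invmx is the actual inverse when the Hessian is invertible, which holds
   whenever mu I <= hessian f x for some mu > 0. *)
Definition newton_step (R : realType) (n : nat) (f : 'cV[R]_n -> R)
    (x : 'cV[R]_n) : 'cV[R]_n :=
  x - invmx (hessian f x) *m gradient f x.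

(* Main.v *)
(* Write H for the Hessian and, for a Newton step from x, put
   d = x - x_* and w = x_N - x_*, so that H(x) w = H(x) d - grad f(x).
   Pairing with w itself, and comparing the derivatives in t of
   <grad f(x_* + t d), w> and of a quadratic polynomial, gives
     mu |w|^2 <= <w, H(x) d> - <w, grad f(x)> <= (M / 2) |d|^2 |w|,
   hence |w| <= M / (2 mu) |d|^2. Since grad f(x_* ) = 0, f(x_* + v) - f(x_* )
   lies between (mu / 2) |v|^2 and (L / 2) |v|^2, so a point whose value is at
   most f(x_N) is within sqrt (L / mu) |w| of x_*.
   The first inequality needs H(x) to be symmetric; this follows from
   computing f(x + s u + s v) - f(x + s u) - f(x + s v) + f(x) by the mean
   value theorem in either order and letting s tend to 0. *)
Require Import Defs.
From mathcomp Require Import all_boot all_order all_algebra.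
From mathcomp Require Import all_classical all_reals all_analysis.
From mathcomp Require Import ring lra.
Import Order.TTheory GRing.Theory Num.Theory.
Import numFieldNormedType.Exports.
Local Open Scope ring_scope.

Set Implicit Arguments.
Unset Strict Implicit.
Unset Printing Implicit Defensive.

Local Notation dot u v := ((u^T *m v) 0 0).

(** * Euclidean inner product, Euclidean norm and spectral norm *)

Section Euclidean.
Variable R : realType.
Implicit Types n : nat.

Lemma dotE n (u v : 'cV[R]_n) : dot u v = \sum_i u i 0 * v i 0.
Proof. by rewrite mxE; apply: eq_bigr => i _; rewrite mxE. Qed.

Lemma dotC n (u v : 'cV[R]_n) : dot u v = dot v u.
Proof. by rewrite !dotE; apply: eq_bigr => i _; rewrite mulrC. Qed.

Lemma dotDl n (u v w : 'cV[R]_n) : dot (u + v) w = dot u w + dot v w.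
Proof. by rewrite raddfD mulmxDl mxE. Qed.

Lemma dotDr n (u v w : 'cV[R]_n) : dot w (u + v) = dot w u + dot w v.
Proof. by rewrite mulmxDr mxE. Qed.

Lemma dotZl n a (u v : 'cV[R]_n) : dot (a *: u) v = a * dot u v.
Proof. by rewrite linearZ -scalemxAl mxE. Qed.

Lemma dotZr n a (u v : 'cV[R]_n) : dot u (a *: v) = a * dot u v.
Proof. by rewrite -scalemxAr mxE. Qed.

Lemma dot_ge0 n (v : 'cV[R]_n) : 0 <= dot v v.
Proof. by rewrite dotE sumr_ge0 // => i _; rewrite -expr2 sqr_ge0. Qed.

Lemma sqr_enorm n (v : 'cV[R]_n) : enorm v ^+ 2 = dot v v.
Proof.
rewrite sqr_sqrtr; last by apply: sumr_ge0 => i _; exact: sqr_ge0.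
by rewrite dotE; apply: eq_bigr => i _; rewrite expr2.
Qed.

Lemma enorm_ge0 n (v : 'cV[R]_n) : 0 <= enorm v.
Proof. exact: sqrtr_ge0. Qed.

Lemma enorm_eq0 n (v : 'cV[R]_n) : enorm v = 0 -> v = 0.
Proof.
move=> v0; have /eqP := sqr_enorm v; rewrite v0 expr0n /= eq_sym dotE.
rewrite psumr_eq0 => [/allP v_eq0|i _]; last by rewrite -expr2 sqr_ge0.
apply/colP => i; rewrite mxE; apply/eqP.
by have := v_eq0 i (mem_index_enum i); rewrite mulf_eq0 orbb.
Qed.

Lemma enorm0 n : enorm (0 : 'cV[R]_n) = 0.
Proof. by apply/eqP; rewrite -sqrf_eq0 sqr_enorm mulmx0 mxE. Qed.

Lemma enormZ n a (v : 'cV[R]_n) : enorm (a *: v) = `|a| * enorm v.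
Proof.
apply/eqP; rewrite -(@eqrXn2 _ 2) ?mulr_ge0 ?enorm_ge0 //.
by rewrite exprMn !sqr_enorm dotZl dotZr mulrA real_normK ?num_real.
Qed.

(** The squared length of [enorm v *: w - enorm w *: v] is twice [enorm w * enorm v] times the gap
    [enorm w * enorm v - dot w v], so the gap is nonnegative. The lower bound comes from replacing
    [u] by [- u]. *)
Lemma Cauchy_Schwarz n (u v : 'cV[R]_n) : `|dot u v| <= enorm u * enorm v.
Proof.
have dot_le (w : 'cV[R]_n) : dot w v <= enorm w * enorm v.
  have [/eqP|u0] := eqVneq (enorm w) 0.
    by move=> /eqP/enorm_eq0 ->; rewrite enorm0 mul0r trmx0 mul0mx mxE.
  have [/eqP|v0] := eqVneq (enorm v) 0.
    by move=> /eqP/enorm_eq0 ->; rewrite enorm0 mulr0 mulmx0 mxE.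
  have := dot_ge0 (enorm v *: w + (- enorm w) *: v).
  rewrite !(dotDl, dotDr, dotZl, dotZr) -!sqr_enorm (dotC v w).
  have uv0 : 0 < enorm w * enorm v by rewrite mulr_gt0 // lt_def enorm_ge0 andbT.
  move=> H; rewrite -subr_ge0 -(pmulr_rge0 _ uv0); lra.
rewrite ler_norml dot_le andbT lerNl.
have := dot_le (- u); rewrite -scaleN1r dotZl mulN1r enormZ.
by rewrite normrN normr1 mul1r.
Qed.

Lemma enormD n (u v : 'cV[R]_n) : enorm (u + v) <= enorm u + enorm v.
Proof.
rewrite -(@ler_pXn2r _ 2) ?nnegrE ?addr_ge0 ?enorm_ge0 //.
rewrite sqr_enorm !(dotDl, dotDr) (dotC v u) -!sqr_enorm.
have := le_trans (ler_norm _) (Cauchy_Schwarz u v); lra.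
Qed.

(** Cauchy-Schwarz row by row gives the Frobenius norm as a bound. It shows that the set in
    [specnorm] is bounded above, so that its [sup] dominates its elements. *)
Lemma enorm_mulmx_bound m n (A : 'M[R]_(m, n)) (v : 'cV[R]_n) :
  enorm (A *m v) <= Num.sqrt (\sum_i enorm (row i A)^T ^+ 2) * enorm v.
Proof.
have C0 : 0 <= \sum_i enorm (row i A)^T ^+ 2.
  by apply: sumr_ge0 => i _; exact: sqr_ge0.
rewrite -(@ler_pXn2r _ 2) ?nnegrE ?mulr_ge0 ?sqrtr_ge0 ?enorm_ge0 //.
rewrite exprMn [X in _ <= X * _]sqr_sqrtr // sqr_enorm dotE mulr_suml.
apply: ler_sum => i _.
have -> : (A *m v) i 0 = dot (row i A)^T v by rewrite trmxK -row_mul [RHS]mxE.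
rewrite -expr2 -exprMn -real_normK ?num_real //.
by rewrite ler_pXn2r ?nnegrE ?mulr_ge0 ?enorm_ge0 // Cauchy_Schwarz.
Qed.

Lemma enorm_mulmx_le m n (A : 'M[R]_(m, n)) (v : 'cV[R]_n) :
  enorm (A *m v) <= specnorm A * enorm v.
Proof.
have [/eqP|v0] := eqVneq (enorm v) 0.
  by move=> /eqP/enorm_eq0 ->; rewrite mulmx0 !enorm0 mulr0.
have v_gt0 : 0 < enorm v by rewrite lt_def v0 enorm_ge0.
rewrite -ler_pdivrMr //.
have -> : enorm (A *m v) / enorm v = enorm (A *m ((enorm v)^-1 *: v)).
  by rewrite -scalemxAr enormZ mulrC ger0_norm // invr_ge0 enorm_ge0.
apply: ub_le_sup.
  exists (Num.sqrt (\sum_i enorm (row i A)^T ^+ 2)) => _ [w /= w1 <-].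
  by apply: le_trans (enorm_mulmx_bound A w) _; rewrite ler_piMr ?sqrtr_ge0.
exists ((enorm v)^-1 *: v) => //=.
by rewrite enormZ ger0_norm ?invr_ge0 ?enorm_ge0 // mulVf.
Qed.

Lemma form_le_specnorm m n (A : 'M[R]_(m, n)) u v :
  `|(u^T *m A *m v) 0 0| <= specnorm A * enorm u * enorm v.
Proof.
rewrite -mulmxA; apply: le_trans (Cauchy_Schwarz _ _) _.
by rewrite mulrAC mulrC ler_wpM2r ?enorm_ge0 // enorm_mulmx_le.
Qed.

End Euclidean.

(** * Derivatives along lines and mean value arguments *)

Section Calculus.
Variable R : realType.


Lemma is_derive_line (V W : normedModType R) (f : V -> W) (p v : V) (t : R) :
  derivable f (p + t *: v) v ->
  is_derive t 1 (fun s : R => f (p + s *: v)) ('D_v f (p + t *: v)).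
Proof.
have E : (fun h : R => h^-1 *: (((fun s : R => f (p + s *: v)) \o shift t)
            (h *: 1) - f (p + t *: v))) =
         (fun h : R => h^-1 *: ((f \o shift (p + t *: v)) (h *: v) -
            f (p + t *: v))).
  apply/funext => h; rewrite /= [h *: 1]mulr1 scalerDl.
  by rewrite addrCA.
move=> df; apply: DeriveDef.
  by rewrite /derivable E.
by rewrite /derive E.
Qed.

(** The mean value theorem for [k - h]. This comparison takes the place of integrating derivatives
    throughout. *)
Lemma le_increment (h k dh dk : R -> R) (a b : R) : a <= b ->
  (forall t : R, is_derive t 1 h (dh t)) -> (forall t : R, is_derive t 1 k (dk t)) ->
  (forall t, a <= t <= b -> dh t <= dk t) ->
  h b - h a <= k b - k a.
Proof.
move=> ab hd kd le_d.
have d (t : R) : is_derive t 1 (k - h) (dk t - dh t) by exact: is_deriveB.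
have [|c cab /= E] := @MVT_segment _ (k - h) (fun t => dk t - dh t) _ _ ab
  (fun t _ => d t).
  apply: derivable_within_continuous => t _; exact: ex_derive.
have : 0 <= (dk c - dh c) * (b - a).
  by rewrite mulr_ge0 ?subr_ge0 // le_d //; move: cab; rewrite in_itv.
rewrite -E !fctE; lra.
Qed.

Lemma mean_value (h dh : R -> R) (a b : R) : a <= b ->
  (forall t : R, is_derive t 1 h (dh t)) ->
  exists2 c, a <= c <= b & h b - h a = dh c * (b - a).
Proof.
move=> ab hd; have [|c cab E] := @MVT_segment _ h dh _ _ ab (fun t _ => hd t).
  apply: derivable_within_continuous => t _; exact: ex_derive.
by exists c => //; move: cab; rewrite in_itv.
Qed.

Section TwiceDifferentiable.
Variables (n : nat) (f : 'cV[R]_n -> R).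
Hypothesis df : twice_differentiable f.

Lemma derive_gradient (x v : 'cV[R]_n) : 'D_v f x = dot (gradient f x) v.
Proof.
have dfx := df.1 x.
rewrite deriveE // dotE.
have {1}-> : v = \sum_i v i 0 *: (delta_mx i 0 : 'cV[R]_n).
  by rewrite {1}[v]matrix_sum_delta; apply: eq_bigr => i _; rewrite big_ord1.
rewrite linear_sum; apply: eq_bigr => i _.
by rewrite linearZ mxE deriveE // mulrC.
Qed.

(** ['D_v f] is a fixed linear combination of the coordinates of the differentiable map
    [gradient f]. The outer direction [u] stands on the left because the row index of [hessian] is
    the outer derivative. *)
Lemma is_derive_gradient (x u v : 'cV[R]_n) :
  is_derive x u (fun y => 'D_v f y) ((u^T *m hessian f x *m v) 0 0).
Proof.
have dg j : differentiable (fun y => 'D_(delta_mx j 0) f y) x.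
  have -> : (fun y => 'D_(delta_mx j 0) f y) =
            (fun N : 'cV[R]_n => N j 0 : R) \o gradient f.
    by apply/funext => y /=; rewrite mxE.
  apply: differentiable_comp; first exact: df.2.
  exact: differentiable_coord.
have -> : (fun y => 'D_v f y) =
          \sum_j (v j 0 *: (fun y => 'D_(delta_mx j 0) f y)).
  apply/funext => y; rewrite derive_gradient dotE fct_sumE.
  by apply: eq_bigr => j _; rewrite mxE mulrC.
suff -> : (u^T *m hessian f x *m v) 0 0 =
          \sum_j (v j 0 *: 'D_u (fun y => 'D_(delta_mx j 0) f y) x).
  apply: is_derive_sum => j; apply: is_deriveZ.
  exact/derivableP/diff_derivable.
rewrite mxE; apply: eq_bigr => j _; rewrite mxE mulrC.
congr (_ * _); rewrite deriveE // -/(_ * _).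
have {2}-> : u = \sum_i u i 0 *: (delta_mx i 0 : 'cV[R]_n).
  by rewrite {1}[u]matrix_sum_delta; apply: eq_bigr => i _; rewrite big_ord1.
rewrite linear_sum; apply: eq_bigr => i _.
by rewrite linearZ !mxE deriveE.
Qed.

End TwiceDifferentiable.
End Calculus.

(** * Second-order bounds for functions of one real variable *)

Section Taylor.
Variable R : realType.

(** Derivatives are compared twice: [dq] with the affine function of slope [c], then [q] with a
    quadratic antiderivative of it. *)
Lemma taylor2_ge (q dq ddq : R -> R) (c : R) :
  (forall t : R, is_derive t 1 q (dq t)) ->
  (forall t : R, is_derive t 1 dq (ddq t)) ->
  (forall t, c <= ddq t) -> q 0 + dq 0 + c / 2 <= q 1.
Proof.
move=> qd dqd le_c.
have dq_ge (t : R) : 0 <= t -> dq 0 + c * t <= dq t.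
  move=> t0; have cd (s : R) : is_derive s 1 (fun s => c * s) c.
    apply: is_derive_eq; rewrite /GRing.scale /=; ring.
  have := le_increment t0 cd dqd (fun s _ => le_c s); lra.
have kd (s : R) : is_derive s 1 (fun s => dq 0 * s + c / 2 * s ^+ 2)
    (dq 0 + c * s).
  apply: is_derive_eq; rewrite /GRing.scale /=.
  by lra.
have := @le_increment _ _ _ _ _ 0 1 ler01 kd qd.
have dq_ge' (t : R) : 0 <= t <= 1 -> dq 0 + c * t <= dq t.
  by move=> /andP[t0 _]; exact: dq_ge.
move=> /(_ dq_ge'); lra.
Qed.

Lemma taylor2_le (q dq ddq : R -> R) (c : R) :
  (forall t : R, is_derive t 1 q (dq t)) ->
  (forall t : R, is_derive t 1 dq (ddq t)) ->
  (forall t, ddq t <= c) -> q 1 <= q 0 + dq 0 + c / 2.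
Proof.
move=> qd dqd le_c.
have := @taylor2_ge (- q) (- dq) (- ddq) (- c) (fun t => is_deriveN (qd t))
  (fun t => is_deriveN (dqd t)).
have le_c' t : - c <= (- ddq) t by rewrite lerN2.
move=> /(_ le_c'); rewrite !fctE; lra.
Qed.

End Taylor.

(** * The Hessian form along lines: symmetry, gradient error, stationarity *)

Section TwiceDifferentiable.
Variables (R : realType) (n : nat) (f : 'cV[R]_n -> R).
Hypothesis df : twice_differentiable f.
Local Notation H := (hessian f).

Lemma is_derive_line1 (p v : 'cV[R]_n) (t : R) :
  is_derive t 1 (fun s : R => f (p + s *: v)) ('D_v f (p + t *: v)).
Proof. by apply/is_derive_line/diff_derivable/df.1. Qed.

Lemma is_derive_line2 (p u v : 'cV[R]_n) (t : R) :
  is_derive t 1 (fun s : R => 'D_v f (p + s *: u))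
    ((u^T *m H (p + t *: u) *m v) 0 0).
Proof.
have D := is_derive_gradient df (p + t *: u) u v.
rewrite -[X in is_derive _ _ _ X](@derive_val _ _ _ _ _ _ _ D).
by apply: (@is_derive_line _ _ _ ('D_v f)); exact: ex_derive.
Qed.

(** The mean value theorem is applied first along [u] to the difference of [f] on two parallel
    lines, then along [v] to ['D_u f]. *)
Lemma second_difference (x u v : 'cV[R]_n) (s : R) : 0 <= s ->
  exists a b : R, [/\ 0 <= a <= s, 0 <= b <= s &
    f (x + s *: v + s *: u) - f (x + s *: u) - f (x + s *: v) + f x =
    (v^T *m H (x + a *: u + b *: v) *m u) 0 0 * s ^+ 2].
Proof.
move=> s0.
have [a a_s Ea] := mean_value s0
  (fun t => is_deriveB (is_derive_line1 (x + s *: v) u t)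
                       (is_derive_line1 x u t)).
have [b b_s Eb] := mean_value s0
  (fun t => is_derive_line2 (x + a *: u) v u t).
exists a, b; split=> //.
move: Ea Eb; rewrite !fctE !scale0r !addr0 !subr0 => Ea Eb.
transitivity (f (x + s *: v + s *: u) - f (x + s *: u) - (f (x + s *: v) - f x)).
  by ring.
by rewrite Ea (addrAC x) Eb; ring.
Qed.

Variable M : R.
Hypothesis HM : forall y z, specnorm (H y - H z) <= M * enorm (y - z).

Lemma hessian_form_lipschitz (y z u v : 'cV[R]_n) :
  `|(u^T *m H y *m v) 0 0 - (u^T *m H z *m v) 0 0| <=
    M * enorm (y - z) * enorm u * enorm v.
Proof.
have -> : (u^T *m H y *m v) 0 0 - (u^T *m H z *m v) 0 0 =
    (u^T *m (H y - H z) *m v) 0 0.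
  by rewrite mulmxBr mulmxBl [RHS]mxE [X in _ = _ + X]mxE.
apply: le_trans (form_le_specnorm _ _ _) _.
by do 2 (apply: ler_wpM2r; first exact: enorm_ge0); exact: HM.
Qed.

Lemma hessian_form_sym (x u v : 'cV[R]_n) :
  (u^T *m H x *m v) 0 0 = (v^T *m H x *m u) 0 0.
Proof.
(* The points from [second_difference] lie within [s * (enorm u + enorm v)] of [x], so [K * s]
   bounds the change of the form; [M] enters by its absolute value since its sign is not given. *)
pose K := `|M| * (enorm u + enorm v) * enorm u * enorm v.
have K0 : 0 <= K by rewrite !mulr_ge0 ?addr_ge0 ?enorm_ge0.
have near (s a b : R) : 0 <= a <= s -> 0 <= b <= s -> forall p q,
    (p = u /\ q = v) \/ (p = v /\ q = u) ->
    `|(q^T *m H (x + a *: p + b *: q) *m p) 0 0 - (q^T *m H x *m p) 0 0|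
      <= K * s.
  move=> /andP[a0 a_s] /andP[b0 b_s] p q pq.
  have dist : enorm (x + a *: p + b *: q - x) <= s * (enorm u + enorm v).
    have -> : x + a *: p + b *: q - x = a *: p + b *: q.
      by rewrite [LHS]addrC !addrA addNr add0r.
    apply: le_trans (enormD _ _) _; rewrite !enormZ !ger0_norm // mulrDr.
    by case: pq => [[-> ->]|[-> ->]]; last rewrite addrC;
      rewrite lerD ?ler_wpM2r ?enorm_ge0.
  apply: le_trans (hessian_form_lipschitz _ _ _ _) _.
  have -> : K * s = `|M| * (s * (enorm u + enorm v)) * enorm q * enorm p.
    by rewrite /K; case: pq => [[-> ->]|[-> ->]]; ring.
  rewrite !ler_wpM2r ?enorm_ge0 //.
  apply: le_trans (ler_wpM2r (enorm_ge0 _) (ler_norm M)) _.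
  exact: ler_wpM2l.
have close s : 0 < s ->
    `|(u^T *m H x *m v) 0 0 - (v^T *m H x *m u) 0 0| <= 2 * K * s.
  move=> s0.
  have [a [b [ha hb E]]] := second_difference x u v (ltW s0).
  have [a' [b' [ha' hb' E']]] := second_difference x v u (ltW s0).
  (* Both sides times [s ^+ 2] are the same second difference, which is symmetric in [u] and [v]. *)
  have Euv : (v^T *m H (x + a *: u + b *: v) *m u) 0 0 =
             (u^T *m H (x + a' *: v + b' *: u) *m v) 0 0.
    apply: (@mulIf _ (s ^+ 2)); first by rewrite expf_neq0 // gt_eqF.
    rewrite -E -E' (addrAC x); ring.
  apply: le_trans (ler_distD ((u^T *m H (x + a' *: v + b' *: u) *m v) 0 0) _ _) _.
  rewrite -mulrA mulr_natl mulr2n lerD //.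
    by rewrite distrC; apply: near => //; right.
  by rewrite -Euv; apply: near => //; left.
apply/eqP; rewrite -subr_eq0 -normr_le0 leNgt; apply/negP => e0.
(* If the gap [e] were positive, [s = e / (4 * K + 1)] would make [2 * K * s] smaller than [e]. *)
have := close _ (divr_gt0 e0 (_ : 0 < 4 * K + 1)).
set e := `|_| in e0 *.
have K1 : 0 < 4 * K + 1 by lra.
move=> /(_ K1).
rewrite mulrA ler_pdivlMr //; nra.
Qed.

(** With A the form at [p + d] and C = M |d|^2 |u|, the derivative of ['D_u f (p + t *: d)] in t is
    at least A - C (1 - t), since the base points are (1 - t) |d| apart. Accumulated over [0, 1],
    this lower bound is A - C / 2. *)
Lemma gradient_taylor (p d u : 'cV[R]_n) :
  (d^T *m H (p + d) *m u) 0 0 - ('D_u f (p + d) - 'D_u f p) <=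
    M / 2 * enorm d ^+ 2 * enorm u.
Proof.
have slope (a q e w t : R) : a - q <= M * ((1 - t) * e) * e * w ->
    a - M * e ^+ 2 * w + M * e ^+ 2 * w * t <= q by lra.
have value (a D e w : R) :
    (a - M * e ^+ 2 * w) * 1 + M * e ^+ 2 * w / 2 * 1 ^+ 2 -
      ((a - M * e ^+ 2 * w) * 0 + M * e ^+ 2 * w / 2 * 0 ^+ 2) <= D ->
    a - D <= M / 2 * e ^+ 2 * w by lra.
have kd (A C s : R) :
    is_derive s 1 (fun s => (A - C) * s + C / 2 * s ^+ 2) (A - C + C * s).
  apply: is_derive_eq; rewrite /GRing.scale /=.
  by lra.
apply: value; have := le_increment ler01
  (kd ((d^T *m H (p + d) *m u) 0 0) (M * enorm d ^+ 2 * enorm u))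
  (is_derive_line2 p d u).
rewrite scale1r scale0r addr0; apply.
move=> t /andP[t0 t1]; apply: slope.
apply: le_trans (ler_norm _) _; apply: le_trans (hessian_form_lipschitz _ _ _ _) _.
have -> : p + d - (p + t *: d) = (1 - t) *: d.
  by rewrite opprD addrACA subrr add0r scalerBl scale1r.
by rewrite enormZ ger0_norm ?subr_ge0.
Qed.

Lemma gradient_min (p v : 'cV[R]_n) : (forall y, f p <= f y) -> 'D_v f p = 0.
Proof.
move=> pmin.
have D := is_derive_line1 p v 0.
have := @derive1_at_min R (fun s => f (p + s *: v)) (-1) 1 0.
have -> : -1 <= 1 :> R by lra.
move=> /(_ isT (fun t _ => @ex_derive _ _ _ _ _ _ _ (is_derive_line1 p v t))).
rewrite in_itv /= ltrN10 ltr01 scale0r addr0 => /(_ isT (fun _ _ => pmin _)) D0.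
have := @derive_val _ _ _ _ _ _ _ D0.
by rewrite (@derive_val _ _ _ _ _ _ _ D) scale0r addr0.
Qed.

End TwiceDifferentiable.

(** * Loewner bounds by scalar matrices *)

Section Loewner.
Variables (R : realType) (n : nat).
Implicit Types (A : 'M[R]_n) (v : 'cV[R]_n).

Lemma form_scalar_mx (a : R) v : (v^T *m a%:M *m v) 0 0 = a * enorm v ^+ 2.
Proof. by rewrite mul_mx_scalar -scalemxAl mxE sqr_enorm. Qed.

Lemma loewner_scalar_le (a : R) A v : loewner_le a%:M A ->
  a * enorm v ^+ 2 <= (v^T *m A *m v) 0 0.
Proof.
move=> /(_ v).
by rewrite mulmxBr mulmxBl mxE [X in _ + X]mxE form_scalar_mx subr_ge0.
Qed.

Lemma loewner_le_scalar (a : R) A v : loewner_le A a%:M ->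
  (v^T *m A *m v) 0 0 <= a * enorm v ^+ 2.
Proof.
move=> /(_ v).
by rewrite mulmxBr mulmxBl mxE [X in _ + X]mxE form_scalar_mx subr_ge0.
Qed.

(** A row [w] with [w *m A = 0] makes the form at [w^T] vanish, while that form is at least
    [a * enorm w^T ^+ 2]; hence the left kernel is trivial. *)
Lemma loewner_scalar_unitmx (a : R) A : 0 < a -> loewner_le a%:M A ->
  A \in unitmx.
Proof.
move=> a0 aA; rewrite -row_free_unit -kermx_eq0; apply/rowV0P => w.
move=> /sub_kermxP wA; apply: (can_inj (@trmxK _ _ _)); rewrite trmx0.
have := loewner_scalar_le w^T aA; rewrite trmxK wA mul0mx mxE pmulr_rle0 //.
move=> w0; apply: enorm_eq0; apply/eqP; rewrite -sqrf_eq0.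
by rewrite eq_le w0 sqr_ge0.
Qed.

End Loewner.

Theorem proposition2 (R : realType) (n : nat) (f : 'cV[R]_n -> R)
    (mu L M : R) (xstar : 'cV[R]_n) (x : nat -> 'cV[R]_n)
    (hf : twice_differentiable f)
    (hmu : 0 < mu) (hmuL : mu <= L)
    (hmin : forall y : 'cV[R]_n, loewner_le mu%:M (hessian f y))
    (hmax : forall y : 'cV[R]_n, loewner_le (hessian f y) L%:M)
    (hM : forall y z : 'cV[R]_n,
       specnorm (hessian f y - hessian f z) <= M * enorm (y - z))
    (hstar : forall y : 'cV[R]_n, f xstar <= f y)
    (hx : forall k : nat, f (x k.+1) <= f (newton_step f (x k))) :
  forall k : nat,
    enorm (x k.+1 - xstar)
      <= Num.sqrt (L / mu) * (M / (2 * mu)) * enorm (x k - xstar) ^+ 2.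
Proof.
move=> k; set d := x k - xstar.
pose w := newton_step f (x k) - xstar.
(* Nonnegativity of this product is read off the Lipschitz bound, as [M] alone may be negative when
   [n = 0]. It settles the case where [w] is zero. *)
have dsq0 : 0 <= M * enorm d ^+ 2.
  have := enorm_mulmx_le (hessian f (x k) - hessian f xstar) d.
  move=> /(le_trans (enorm_ge0 _))/le_trans; rewrite expr2 mulrA; apply.
  by rewrite ler_wpM2r ?enorm_ge0.
have Hw : hessian f (x k) *m w = hessian f (x k) *m d - gradient f (x k).
  rewrite /w /newton_step addrAC mulmxBr mulKVmx //.
  exact: (loewner_scalar_unitmx hmu).
have newton : enorm w <= M / (2 * mu) * enorm d ^+ 2.
  (* Symmetry moves [d] to the left, giving the form that [gradient_taylor] bounds. *)
  have E : (w^T *m hessian f (x k) *m w) 0 0 =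
      (d^T *m hessian f (x k) *m w) 0 0 - 'D_w f (x k).
    rewrite -mulmxA Hw mulmxBr mxE [X in _ + X]mxE mulmxA.
    by rewrite (hessian_form_sym hf hM) derive_gradient // (dotC w).
  have := gradient_taylor hf hM xstar d w.
  have -> : xstar + d = x k by rewrite addrC subrK.
  rewrite (gradient_min hf _ hstar) subr0 -E.
  move=> /(le_trans (loewner_scalar_le w (hmin _))).
  (* One factor [enorm w] is cancelled below, hence the split on whether it vanishes. *)
  have := enorm_ge0 w; rewrite le_eqVlt => /predU1P[<- _|w0].
    by rewrite mulrAC divr_ge0 // mulr_ge0 // ltW.
  rewrite expr2 mulrA ler_pM2r // => le_w.
  rewrite -(ler_pM2l hmu); apply: le_trans le_w _.
  by rewrite le_eqVlt; apply/orP; left; apply/eqP; field; rewrite gt_eqF.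
have value v := is_derive_line1 hf xstar v.
have slope v := is_derive_line2 hf xstar v v.
have lower := taylor2_ge (value (x k.+1 - xstar)) (slope _)
  (fun t => loewner_scalar_le _ (hmin _)).
have upper := taylor2_le (value w) (slope _)
  (fun t => loewner_le_scalar _ (hmax _)).
move: lower upper; rewrite !scale1r !scale0r !addr0.
rewrite !(gradient_min hf _ hstar) !addr0 /w !(addrC xstar) !subrK -/w => lower upper.
(* The chain is [lower], then the decrease hypothesis [hx], then [upper], with the common factor 1/2
   and the common term [f xstar] removed. *)
have growth : mu * enorm (x k.+1 - xstar) ^+ 2 <= L * enorm w ^+ 2.
  rewrite -(ler_pM2r (_ : 0 < 2^-1)) ?invr_gt0 //.
  rewrite -(lerD2l (f xstar)).
  exact: le_trans lower (le_trans (hx k) upper).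
(* It remains to bound [enorm (x k.+1 - xstar)] by [Num.sqrt (L / mu) * enorm w], which is [growth]
   after squaring. *)
rewrite -mulrA; apply: le_trans (ler_wpM2l (sqrtr_ge0 _) newton).
have L0 : 0 <= L by apply: le_trans hmuL; exact: ltW.
rewrite -(@ler_pXn2r _ 2) ?nnegrE ?mulr_ge0 ?sqrtr_ge0 ?enorm_ge0 //.
rewrite exprMn [X in _ <= X * _]sqr_sqrtr ?divr_ge0 ?(ltW hmu) //.
by rewrite mulrAC ler_pdivlMr // mulrC.
Qed.
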